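(* Let $\ell > 3$ be an odd integer. Suppose $n = 2\ell + \alpha$, where $\alpha > 0$ and $\alpha = \beta(\ell+1) + \gamma(3\ell+1)$ for some nonnegative integers $\beta,\gamma$. Then the honeycomb toroidal graph $\mathrm{HTG}(1,n,\ell)$ is 2-spanning cyclable.
   Context: For integers $m\ge 1$, $\ell\ge 0$ and $n\ge 4$ with $n$ even and $m-\ell$ even, the honeycomb toroidal graph $\mathrm{HTG}(m,n,\ell)$ is the simple graph with vertex set $\{u_{i,j}: 0\le i\le m-1,\ 0\le j\le n-1\}$ (first subscript computed modulo $m$, second modulo $n$) whose edge set is the set of the following unordered pairs: $\{u_{i,j},u_{i,j+1}\}$ for all $i,j$ (vertical edges); $\{u_{i,j},u_{i+1,j}\}$ for all $0\le i\le m-2$ with $i+j$ odd (flat edges); and $\{u_{m-1,j},u_{0,j+\ell}\}$ for all $j$ having the same parity as $m$ (and $\ell$) (jump edges). In particular, for $m=1$ the graph has vertices $u_{0,0},\dots,u_{0,n-1}$, the cycle edges $\{u_{0,j},u_{0,j+1}\}$, and the edges $\{u_{0,j},u_{0,j+\ell}\}$ for odd $j$. A 2-factor of a graph is a spanning subgraph in which every vertex has valency 2. A graph $X$ is 2-spanning cyclable if for every pair of distinct vertices $u,v$ of $X$ there is a 2-factor of $X$ consisting of exactly two cycles such that $u$ and $v$ lie in different cycles. *)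

(* Defs.v *)
From mathcomp Require Import all_boot.

Set Implicit Arguments.
Unset Strict Implicit.
Unset Printing Implicit Defensive.

Record sgraph := SGraph {
  vertex :> finType;
  adj : rel vertex;
  adj_sym : symmetric adj;
  adj_irr : irreflexive adj
}.

Section TwoFactors.
Variable X : sgraph.

(* A spanning subgraph of X is given by its adjacency relation on the whole
   vertex set. *)
Definition spanning_subgraph (F : rel X) : Prop :=
  symmetric F /\ subrel F (@adj X).

Definition valency (F : rel X) (x : X) : nat := #|[set y | F x y]|.

Definition two_factor (F : rel X) : Prop :=
  spanning_subgraph F /\ forall x : X, valency F x = 2.

(* A cycle is listed by its vertices in cyclic order; without the bound on the
   size, a single edge would be counted as a cycle of length 2. *)
Definition is_cycle (F : rel X) (c : seq X) : bool :=
  [&& 2 < size c, uniq c & cycle F c].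

Definition cycle_edge (c : seq X) : rel X :=
  [rel x y | [&& x \in c, y \in c & (y == next c x) || (x == next c y)]].

Definition consists_of_two_cycles (F : rel X) (c d : seq X) : Prop :=
  [/\ is_cycle F c, is_cycle F d, [disjoint c & d] &
      forall x y : X, F x y = cycle_edge c x y || cycle_edge d x y].

Definition two_spanning_cyclable : Prop :=
  forall u v : X, u != v ->
    exists F : rel X, two_factor F /\
      exists c d : seq X,
        [/\ consists_of_two_cycles F c d, u \in c & v \in d].

End TwoFactors.

Section HTG.
Variables m n l : nat.

(* The pair (i, j) is the vertex u_{i,j}. *)
Implicit Types x y : 'I_m * 'I_n.

Definition vertical x y : bool :=
  (y.1 == x.1) && (y.2 == (x.2 + 1) %% n :> nat).

Definition flat x y : bool :=
  [&& y.1 == x.1 + 1 :> nat, odd (x.1 + x.2) & y.2 == x.2].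

Definition jump x y : bool :=
  [&& x.1 == m - 1 :> nat, y.1 == 0 :> nat, odd x.2 == odd m
    & y.2 == (x.2 + l) %% n :> nat].

Definition htg_arc x y : bool := [|| vertical x y, flat x y | jump x y].

Definition htg_adj x y : bool := (x != y) && (htg_arc x y || htg_arc y x).

Lemma htg_adj_sym : symmetric htg_adj.
Proof. by move=> x y; rewrite /htg_adj eq_sym orbC. Qed.

Lemma htg_adj_irr : irreflexive htg_adj.
Proof. by move=> x; rewrite /htg_adj eqxx. Qed.

Definition HTG : sgraph := SGraph htg_adj_sym htg_adj_irr.

(* HTG m n l is the honeycomb toroidal graph when 4 <= n, n is even and m - l is
   even; under these parity conditions no arc is a loop, so that the conjunct
   x != y in htg_adj is redundant. *)
Lemma htg_arc_irr :
  ~~ odd n -> odd m = odd l -> forall x, htg_arc x x = false.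
Proof.
move=> n_even ml_parity [i j]; apply/negP.
have E k : odd (k %% n) = odd k by apply: odd_mod; apply: negbTE.
case/or3P => [/andP[_ /= /eqP H]|/and3P[/= /eqP H _ _]
             |/and4P[/= /eqP Hm /eqP H0 _ /eqP H]].
- by have := congr1 odd H; rewrite E oddD; case: (odd j).
- by move/esym/eqP: H; rewrite -[X in _ == X]addn0 eqn_add2l.
- have := congr1 odd H; rewrite E oddD -ml_parity.
  have m_gt0 : 0 < m by apply: leq_ltn_trans (ltn_ord i).
  have m1 : m = 1 by rewrite -(subnK m_gt0) -Hm H0.
  by rewrite m1; case: (odd j).
Qed.

Lemma htg_adjE : ~~ odd n -> odd m = odd l ->
  forall x y, htg_adj x y = htg_arc x y || htg_arc y x.
Proof.
move=> n_even ml_parity x y; rewrite /htg_adj.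
by have [->|//] := eqVneq x y; rewrite htg_arc_irr.
Qed.

End HTG.

(* Main.v *)
Require Import Defs.
From mathcomp Require Import all_boot zify.

(* The 2-factor has a hexagon as one of its two cycles: for l > 3 the rotations
   of a hexagon separate any two vertices, so it is enough to make the rest of
   the graph a single cycle.  Number the vertices so that the chords join x and
   x + l for x even.  A 2-factor is the complement of a perfect matching, and a
   perfect matching with at least one chord is given by its chords {s, s + l}
   (s in S).  Away from these chords the 2-factor runs in parallel strands, one
   for each even residue modulo l + 1, and a removed chord acts on the strands as
   a generator of the Temperley-Lieb algebra does: two neighbouring strands are
   joined on either side of it, and the others pass through, rotated by -2.  The
   chords at 0 and 2l make the hexagon.  Adding l + 1 to n changes nothing, and
   the part 3l + 1 compensates for the rotation caused by one more chord.  Chords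
   are placed so that the strands they join alternate between two neighbouring
   pairs; by e_i e_j e_i = e_i, two additional chords have no effect, which leaves
   the cases of gamma even and gamma odd. *)

Set Implicit Arguments.
Unset Strict Implicit.
Unset Printing Implicit Defensive.

(** * Cycles of a 2-factor *)

Section TwoFactorCycles.
Variables (X : sgraph) (F : rel X).
Hypothesis F_factor : two_factor F.

Let F_sym : symmetric F. Proof. by case: F_factor => -[]. Qed.

Let F_irr x : F x x = false.
Proof.
by case: F_factor => -[_ sub] _; apply/negP => /sub; rewrite adj_irr.
Qed.

Lemma two_factor_nbrs x y z t : F x y -> F x z -> y != z -> F x t ->
  (t == y) || (t == z).
Proof.
move=> Fxy Fxz yz Fxt; have [_ /(_ x) card2] := F_factor.
have: [set y; z] == [set w | F x w].
  rewrite eqEcard cards2 yz -[#|[set w | F x w]|]/(valency F x) card2 andbT.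
  by apply/subsetP => w /set2P[] ->; rewrite inE.
by move=> /eqP/setP/(_ t); rewrite !inE Fxt => ->.
Qed.

Lemma two_factor_other x y : exists2 z, F x z & z != y.
Proof.
have [_ /(_ x)/eqP/cards2P[a [b [ab E]]]] := F_factor.
have [Fa Fb] : F x a /\ F x b.
  by move/setP: E => E; move: (E a) (E b); rewrite !inE !eqxx orbT.
have [ay|] := eqVneq a y; last by exists a.
by exists b => //; rewrite -ay eq_sym.
Qed.

(** Equality would give [next c (next c x) = x], which happens only in cycles of length at most
    2. *)
Lemma cycle_next_neq_prev (c : seq X) x : is_cycle F c -> x \in c ->
  next c x != prev c x.
Proof.
case/and3P => c_size c_uniq _ xc; apply/eqP => E.
have: next c (next c x) = x by rewrite E next_prev.
case: (rot_to xc) => i c' Ec.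
have U : uniq (x :: c') by rewrite -Ec rot_uniq.
have: 2 < size (x :: c') by rewrite -Ec size_rot.
rewrite -!(next_rot i c_uniq) Ec.
case: c' U {Ec} => [|a [|b c']] // U _.
have xa : (x == a) = false.
  by apply/negP => /eqP xa; move: U; rewrite xa /= mem_head.
rewrite /= eqxx [a == x]eq_sym xa eqxx => bx.
by move: U; rewrite bx /= !inE eqxx orbT.
Qed.

(** [next c x] and [prev c x] are two distinct neighbours of [x], so valency 2 leaves no others. *)
Lemma two_factor_cycleE (c : seq X) x y : is_cycle F c -> x \in c ->
  F x y = cycle_edge c x y.
Proof.
move=> c_cyc xc; have c_np := cycle_next_neq_prev c_cyc xc.
case/and3P: c_cyc => _ c_uniq c_cycle.
have Fn : F x (next c x) by apply: next_cycle.
have Fp : F x (prev c x) by rewrite F_sym; apply: prev_cycle.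
apply/idP/idP => [Fxy | /and3P[_ _ /orP[] /eqP E]].
- have /orP[/eqP->|/eqP->] := two_factor_nbrs Fn Fp c_np Fxy.
    by rewrite /cycle_edge /= xc mem_next xc eqxx.
  by rewrite /cycle_edge /= xc mem_prev xc next_prev // eqxx orbT.
- by rewrite E.
- by move: Fp; rewrite E prev_next.
Qed.

Lemma two_factor_cycle_closed (c : seq X) x y : is_cycle F c -> F x y ->
  (x \in c) = (y \in c).
Proof.
move=> c_cyc Fxy; apply/idP/idP => [xc|yc].
  by move: Fxy; rewrite (two_factor_cycleE y c_cyc xc) => /and3P[].
by move: Fxy; rewrite F_sym (two_factor_cycleE x c_cyc yc) => /and3P[].
Qed.

Lemma two_factor_cycle_connect (c : seq X) x y : is_cycle F c ->
  connect F x y -> (x \in c) = (y \in c).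
Proof.
move=> c_cyc; apply: (@closed_connect X F [in c]) => a b.
exact: two_factor_cycle_closed.
Qed.

(* A longest path from x must close up at x: an end vertex adjacent to an inner
   vertex of the path would give the latter a third neighbour. *)
Lemma two_factor_path_cycle x p : path F x p -> uniq (x :: p) ->
  exists2 c, is_cycle F c & x \in c.
Proof.
have [k le_k] := ubnP (#|X| - size p); elim: k p le_k => // k IHk p le_k px U.
set z := last x p.
have p_lt : size p < #|X|.
  by rewrite -[(size p).+1]/(size (x :: p)) -(card_uniqP U) max_card.
have extend w : F z w -> w \notin x :: p -> exists2 c, is_cycle F c & x \in c.
  move=> Fzw wN; apply: (IHk (rcons p w)); last 2 first.
  - by rewrite rcons_path px.
  - by rewrite -rcons_cons rcons_uniq wN.
  by rewrite size_rcons; lia.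
case: (lastP p) @z px U p_lt extend le_k => [|q z'] z.
  move=> _ _ _ extend _; have [w Fw wx] := two_factor_other x x.
  by apply: (extend w Fw); rewrite inE.
rewrite {}/z last_rcons => {p} px U p_lt extend le_k; set z := z' in px U *.
have [w Fzw w_neq] := two_factor_other z (last x q).
have [wN|w_in] := boolP (w \in x :: rcons q z); last exact: (extend w).
have Fqz : F (last x q) z by move: px; rewrite rcons_path => /andP[].
have [wx|wx] := eqVneq w x.
  exists (x :: rcons q z); last exact: mem_head.
  rewrite /is_cycle U /= rcons_path px last_rcons -wx Fzw size_rcons andbT /=.
  by case: q w_neq {px U p_lt extend le_k wN Fqz} => //=; rewrite wx eqxx.
have wq : w \in q.
  move: wN; rewrite inE (negPf wx) mem_rcons inE /=.
  by have [wz|//] := eqVneq w z; rewrite wz F_irr in Fzw.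
exfalso; case/splitPr: wq px U w_neq => q1 q2.
rewrite rcons_cat rcons_cons cat_path /= => /and3P[_ Faw].
case: q2 => [|b q2]; first by rewrite last_cat /= eqxx.
rewrite rcons_cons /= => /andP[Fwb _] U _.
have {U}: uniq ((x :: q1) ++ w :: b :: rcons q2 z) by [].
rewrite cat_uniq => /and3P[_ /hasPn disj /and3P[_ bN _]].
have neq c : c \in w :: b :: rcons q2 z -> c != last x q1.
  by move=> /disj; apply: contraNneq => ->; apply: mem_last.
have ab : last x q1 != b by rewrite eq_sym neq // !inE eqxx orbT.
have Fwa : F w (last x q1) by rewrite F_sym.
have Fwz : F w z by rewrite F_sym.
have z_in : z \in w :: b :: rcons q2 z by rewrite !inE mem_rcons mem_head !orbT.
case/orP: (two_factor_nbrs Fwa Fwb ab Fwz) => /eqP E.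
  by move: (neq z z_in); rewrite E eqxx.
by move: bN; rewrite -E mem_rcons mem_head.
Qed.

Lemma two_factor_cycle x : exists2 c, is_cycle F c & x \in c.
Proof. exact: (@two_factor_path_cycle x [::]). Qed.

End TwoFactorCycles.

(** Cycles of a 2-factor are closed under [F], so the cycle through [x0] takes in the complement of
    [d] and avoids [d]. *)
Lemma two_cycles_of_connect (X : sgraph) (F : rel X) (d : seq X) x0 :
  two_factor F -> is_cycle F d -> x0 \notin d ->
  (forall x, x \notin d -> connect F x0 x) ->
  exists2 c, consists_of_two_cycles F d c & forall x, (x \in c) = (x \notin d).
Proof.
move=> F_factor d_cyc x0d conn.
have [c c_cyc x0c] := two_factor_cycle F_factor x0.
have cE x : (x \in c) = (x \notin d).
  have [xd|/conn x0x] := boolP (x \in d); last first.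
    by rewrite -(two_factor_cycle_connect F_factor c_cyc x0x).
  apply/negP => xc; have /and3P[_ _ c_cycle] := c_cyc.
  have := two_factor_cycle_connect F_factor d_cyc (connect_cycle c_cycle x0c xc).
  by rewrite xd (negPf x0d).
exists c => //; split=> //.
  by rewrite disjoint_sym disjoint_has; apply/hasPn => x; rewrite cE.
move=> x y; have [xd|xd] := boolP (x \in d).
  rewrite (two_factor_cycleE F_factor y d_cyc xd).
  by rewrite [cycle_edge c x y]/cycle_edge /= cE xd orbF.
rewrite (two_factor_cycleE F_factor y c_cyc) ?cE //.
by rewrite [cycle_edge d x y]/cycle_edge /= (negPf xd).
Qed.

(** An involution moving every vertex along an edge encodes a perfect matching. *)
Lemma two_factor_remove_matching (X : sgraph) (mate : X -> X) :
  (forall x : X, #|[set y | adj x y]| = 3) -> involutive mate ->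
  (forall x : X, adj x (mate x)) ->
  two_factor [rel x y : X | adj x y && (y != mate x)].
Proof.
move=> cubic mateK adj_mate; split; first split.
- move=> x y /=; rewrite adj_sym; congr (_ && ~~ _).
  by apply/eqP/eqP => ->.
- by move=> x y /andP[].
move=> x; apply/eqP; rewrite -(eqn_add2l 1) -[X in _ == X](cubic x).
rewrite (cardsD1 (mate x) [set y | adj x y]) inE adj_mate eqn_add2l.
by apply/eqP/eq_card => y; rewrite !inE andbC.
Qed.

(** * 2-factors of HTG(1, n, l) given by their missing chords *)

Section Coordinates.
Variables l n j : nat.
Hypotheses (l_odd : odd l) (l_gt1 : 1 < l) (n_even : ~~ odd n).
Hypotheses (n_gt2l : 2 * l < n) (j_odd : odd j).

Let n_gt0 : 0 < n := leq_ltn_trans (leq0n _) n_gt2l.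

(* Since j is odd, the edges u_{0,i} u_{0,i+l} with i odd join vtx x to
   vtx (x + l) for x even. *)
Definition vtx (x : nat) : HTG 1 n l :=
  (ord0, Ordinal (ltn_pmod (x + j) n_gt0)).

(** The inverse of [vtx] on [0, ..., n - 1]; [n - j %% n] stands for [-j] modulo [n]. *)
Definition pos (v : HTG 1 n l) : nat := (v.2 + (n - j %% n)) %% n.

Lemma vtx_eq x y : (vtx x == vtx y) = (x == y %[mod n]).
Proof. by rewrite -(eqn_modDr j x y). Qed.

Lemma vtx_congr x y : x = y %[mod n] -> vtx x = vtx y.
Proof. by move=> E; apply/eqP; rewrite vtx_eq E. Qed.

Lemma vtxDn x : vtx (x + n) = vtx x.
Proof. by apply: vtx_congr; rewrite modnDr. Qed.

Lemma vtx_neq x y : x < y < x + n -> vtx x != vtx y.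
Proof.
move=> xy; rewrite vtx_eq eq_sym eqn_mod_dvd; last lia.
by apply/negP => /dvdn_leq; lia.
Qed.

Lemma pos_lt v : pos v < n.
Proof. exact: ltn_pmod. Qed.

Lemma vtx_pos v : vtx (pos v) = v.
Proof.
case: v => i k; rewrite /vtx /pos /= (ord1 i); congr (_, _); apply: val_inj => /=.
rewrite modnDml -modnDmr -addnA subnK; last exact/ltnW/ltn_pmod.
by rewrite modnDr modn_small.
Qed.

Lemma pos_vtx x : x < n -> pos (vtx x) = x.
Proof.
move=> x_lt; have /eqP := vtx_pos (vtx x).
by rewrite vtx_eq => /eqP; rewrite !modn_small ?pos_lt.
Qed.

Definition chord x := if odd x then x + n - l else x + l.

Lemma htg1_adj (u v : HTG 1 n l) : adj u v =
  (v.2 == (u.2 + 1) %% n :> nat) || (odd u.2 && (v.2 == (u.2 + l) %% n :> nat))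
  || ((u.2 == (v.2 + 1) %% n :> nat) ||
      (odd v.2 && (u.2 == (v.2 + l) %% n :> nat))).
Proof.
rewrite /adj /= htg_adjE ?l_odd //.
case: u v => [i a] [i' b]; rewrite /htg_arc /vertical /flat /jump /=.
by rewrite !ord1 /= !eqb_id.
Qed.

Lemma odd_vtx x : odd (vtx x).2 = ~~ odd x.
Proof. by rewrite /= odd_mod ?(negPf n_even) // oddD j_odd addbT. Qed.

Lemma vtx_adjP x y : adj (vtx x) (vtx y) =
  (vtx y \in [:: vtx (x + 1); vtx (x + n - 1); vtx (chord x)]).
Proof.
have E a b d : ((vtx a).2 == ((vtx b).2 + d) %% n :> nat) = (vtx a == vtx (b + d)).
  by rewrite vtx_eq -(eqn_modDr j a) /= modnDml addnAC.
rewrite htg1_adj !odd_vtx !E !inE.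
(* Arcs entering [vtx x] are rewritten as shifts of [x]; parity then decides which of the two
   possible chords occurs. *)
have flip a : 0 < a < n -> (vtx x == vtx (y + a)) = (vtx y == vtx (x + n - a)).
  move=> a_lt; rewrite !vtx_eq -(eqn_modDr a y) subnK; last lia.
  by rewrite modnDr eq_sym.
rewrite !flip /chord; try lia.
case: (boolP (odd x)) => xo /=.
  rewrite orbF; case: (boolP (vtx y == vtx (x + n - l))) => [|_].
    rewrite vtx_eq => /eqP/(congr1 odd).
    rewrite !odd_mod ?(negPf n_even) // oddB; last lia.
    by rewrite oddD xo (negPf n_even) l_odd /= => ->.
  by rewrite andbF orbF.
case: (boolP (vtx y == vtx (x + n - l))) => [|_]; last by rewrite andbF !orbF orbAC orbA.
rewrite vtx_eq => /eqP/(congr1 odd).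
rewrite !odd_mod ?(negPf n_even) // oddB; last lia.
rewrite oddD (negPf xo) (negPf n_even) l_odd /= => -> /=.
by rewrite orbF orbAC orbA.
Qed.

Lemma htg1_cubic (v : HTG 1 n l) : #|[set w | adj v w]| = 3.
Proof.
rewrite -(vtx_pos v); set x := pos v; have x_lt := pos_lt v.
pose s := [:: vtx (x + 1); vtx (x + n - 1); vtx (chord x)].
have /eq_card -> : [set w | adj (vtx x) w] =i s.
  by move=> w; rewrite inE -(vtx_pos w) vtx_adjP.
rewrite -[3]/(size s); apply/card_uniqP.
rewrite /= !inE negb_or !andbT -andbA; apply/and3P; rewrite /chord; split.
- by apply: vtx_neq; lia.
- by apply: vtx_neq; case: ifP => _; lia.
- by case: ifP => _; [rewrite eq_sym|rewrite eq_sym]; apply: vtx_neq; lia.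
Qed.

(* The chords s -- s + l with S s are removed; on either side of such a chord
   the removed edges of the cycle 0, 1, ..., n - 1 must then alternate with the
   kept ones, and inside tells which way. *)
Variable S : pred nat.
Hypotheses (S0 : S 0) (S_even : forall s, S s -> ~~ odd s).
Hypothesis (S_lt : forall s, S s -> s + l < n).
Hypothesis (S_sep : forall s t, S s -> S t -> s < t -> s + l < t).

Definition inside y := has (fun s => S s && (s < y < s + l)) (iota 0 n).

Lemma insideP y : reflect (exists2 s, S s & s < y < s + l) (inside y).
Proof.
apply: (iffP hasP) => [[s _ /andP[Ss sy]]|[s Ss sy]]; first by exists s.
by exists s; [rewrite mem_iota; have := S_lt Ss; lia|rewrite Ss].
Qed.

Lemma S_uniq s t y : S s -> S t -> s <= y <= s + l -> t <= y <= t + l -> s = t.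
Proof.
move=> Ss St sy ty; case: (ltngtP s t) => // [/(S_sep Ss St)|/(S_sep St Ss)]; lia.
Qed.

(** The parity rule is consistent: [s + 1, ..., s + l - 1] starts at an odd number and has even
    length, and the stretch after it starts at the even number [s + l + 1]. *)
Definition mate y :=
  if S y then y + l else if (l <= y) && S (y - l) then y - l
  else if odd y == inside y then y.+1 else y.-1.

Lemma mate_start s : S s -> mate s = s + l.
Proof. by rewrite /mate => ->. Qed.

Lemma mate_end s : S s -> mate (s + l) = s.
Proof.
move=> Ss; rewrite /mate addnK leq_addl Ss ifN //.
by apply/negP => Ssl; have := S_sep Ss Ssl; lia.
Qed.

Lemma mate_inside s y : S s -> s < y < s + l ->
  mate y = if odd y then y.+1 else y.-1.
Proof.
move=> Ss sy; rewrite /mate.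
have /negP ny : ~ S y by move=> Sy; have := S_uniq Ss Sy (y := y); lia.
rewrite (negPf ny).
have /negP nyl : ~ ((l <= y) && S (y - l)).
  by case/andP=> ly Syl; have := S_uniq Ss Syl (y := y); lia.
rewrite (negPf nyl).
have -> : inside y by apply/insideP; exists s.
by rewrite eqb_id.
Qed.

Lemma mate_outside y : (forall s, S s -> (y < s) || (s + l < y)) ->
  mate y = if odd y then y.-1 else y.+1.
Proof.
move=> out; rewrite /mate.
have /negP ny : ~ S y by move=> /out; lia.
rewrite (negPf ny).
have /negP nyl : ~ ((l <= y) && S (y - l)) by case/andP=> ly /out; lia.
rewrite (negPf nyl).
have -> : inside y = false by apply/negP => /insideP[s /out]; lia.
by case: odd.
Qed.

Lemma mate_cases (P : nat -> Prop) :
  (forall s, S s -> P s) -> (forall s, S s -> P (s + l)) ->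
  (forall s y, S s -> s < y < s + l -> P y) ->
  (forall y, (forall s, S s -> (y < s) || (s + l < y)) -> P y) ->
  forall y, P y.
Proof.
move=> P_start P_end P_in P_out y.
case: (boolP (inside y)) => [/insideP[s Ss sy]|/insideP ny]; first exact: (P_in s).
case: (boolP (S y)) => [/P_start//|Sy].
case: (boolP ((l <= y) && S (y - l))) => [/andP[ly /P_end]|].
  by rewrite subnK.
move=> Syl; apply: P_out => s Ss; apply/negP => /negP sy.
have /negP : ~ (s < y < s + l) by move=> sy'; apply: ny; exists s.
have ys : y != s by apply: contraNneq Sy => ->.
have ysl : y != s + l.
  by apply: contraNneq Syl => ->; rewrite leq_addl addnK.
move: sy ys ysl; lia.
Qed.

Lemma mateP y : y < n -> [/\ mate y < n, mate (mate y) = y &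
  adj (vtx y) (vtx (mate y))].
Proof.
move=> y_lt; suff [m_lt mK m_adj] : [/\ mate y < n, mate (mate y) = y &
    [\/ mate y = y + 1, mate y + 1 = y | vtx (mate y) = vtx (chord y)]].
  split=> //; rewrite vtx_adjP; case: m_adj => E.
  - by rewrite E mem_head.
  - have -> : y + n - 1 = mate y + n by lia.
    by rewrite vtxDn !inE eqxx orbT.
  - by rewrite E !inE eqxx !orbT.
move: y y_lt; apply: mate_cases => [s|s|s y|y].
- move=> Ss _; rewrite mate_start // mate_end // /chord (negPf (S_even Ss)).
  by split=> //; [exact: S_lt|apply: Or33].
- move=> Ss _; rewrite mate_end // mate_start //; split=> //.
    by have := S_lt Ss; lia.
  apply: Or33; rewrite /chord oddD (negPf (S_even Ss)) l_odd /=.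
  by rewrite addnAC addnK vtxDn.
- move=> Ss sy y_lt; have s_even := S_even Ss; have sl_lt := S_lt Ss.
  rewrite (mate_inside Ss sy); case: (boolP (odd y)) => y_odd.
    rewrite (@mate_inside s) //=; last lia.
    by rewrite y_odd /= addn1; split=> //; [lia|apply: Or31].
  rewrite (@mate_inside s) //=; last lia.
  have -> : odd y.-1 by lia.
  by split; [lia|lia|apply: Or32; lia].
- move=> out y_lt; rewrite (mate_outside out); case: (boolP (odd y)) => y_odd.
    rewrite (@mate_outside y.-1); last first.
      by move=> s Ss; have := out s Ss; have := S_even Ss; lia.
    have -> : odd y.-1 = false by lia.
    by split; [lia|lia|apply: Or32; lia].
  rewrite (@mate_outside y.+1); last first.
    by move=> s Ss; have := out s Ss; have := S_even Ss; lia.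
  by rewrite /= (negPf y_odd) /=; split; [lia|lia|apply: Or31; lia].
Qed.

Definition vmate (v : HTG 1 n l) := vtx (mate (pos v)).

Definition factor : rel (HTG 1 n l) := [rel u v | adj u v && (v != vmate u)].

Lemma factor_two_factor : two_factor factor.
Proof.
apply: two_factor_remove_matching; first exact: htg1_cubic.
  move=> v; have [m_lt mK _] := mateP (pos_lt v).
  by rewrite /vmate pos_vtx // mK vtx_pos.
by move=> v; rewrite -{1}(vtx_pos v); have [] := mateP (pos_lt v).
Qed.

Lemma factor_sym : symmetric factor.
Proof. by case: factor_two_factor => -[]. Qed.

Lemma factor_edge x y : x < n -> adj (vtx x) (vtx y) -> mate x <> y %% n ->
  factor (vtx x) (vtx y).
Proof.
move=> x_lt xy mx; have [m_lt _ _] := mateP x_lt.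
apply/andP; split=> //; rewrite /vmate pos_vtx // eq_sym vtx_eq.
by rewrite [mate x %% n]modn_small //; apply/eqP.
Qed.

Lemma adj_succ x : adj (vtx x) (vtx x.+1).
Proof. by rewrite vtx_adjP addn1 mem_head. Qed.

Lemma adj_chord x : ~~ odd x -> adj (vtx x) (vtx (x + l)).
Proof. by move=> /negPf x_even; rewrite vtx_adjP /chord x_even !inE eqxx !orbT. Qed.

(** * Moves along the 2-factor *)

Notation "x ~ y" := (connect factor (vtx x) (vtx y)) (at level 70).

Lemma conn_sym x y : x ~ y -> y ~ x.
Proof. by rewrite (sym_connect_sym factor_sym). Qed.

Lemma conn_trans x y z : x ~ y -> y ~ z -> x ~ z.
Proof. exact: connect_trans. Qed.

(** Upper ends [s + l] of removed chords are odd, so an even vertex outside [S] is matched along the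
    cycle and keeps its chord. *)
Lemma factor_chord y : y < n -> ~~ odd y -> ~~ S y ->
  factor (vtx y) (vtx (y + l)).
Proof.
move=> y_lt y_even Sy; apply: factor_edge => //; first exact: adj_chord.
have Syl : ~~ ((l <= y) && S (y - l)).
  by apply/negP => /andP[ly /S_even]; move: y_even l_odd ly; lia.
rewrite /mate (negPf Sy) (negPf Syl).
have [yl_lt|yl_ge] := ltnP (y + l) n; first by rewrite modn_small //; case: ifP; lia.
have -> : y + l = y + l - n + n by lia.
by rewrite modnDr modn_small; [case: ifP; lia|lia].
Qed.

(* From y along the chord to y + l and then along the cycle: upwards outside the
   intervals [s, s + l], downwards inside them. *)
Lemma conn_up y : ~~ odd y -> y + l < n ->
  (forall s, S s -> s < y \/ y + l <= s) -> y ~ y + l + 1.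
Proof.
move=> y_even yl_lt noS.
have Sy : ~~ S y by apply/negP => /noS; lia.
have F1 := factor_chord (leq_ltn_trans (leq_addr l y) yl_lt) y_even Sy.
apply: connect_trans (connect1 F1) (connect1 _); rewrite addn1.
apply: factor_edge; [done|exact: adj_succ|].
(* Here [y + l] is odd and [s] is even, so [y + l <= s] is strict. *)
rewrite mate_outside; last by move=> s Ss; have := noS s Ss; have := S_even Ss; lia.
rewrite oddD l_odd (negPf y_even) /=.
have [yl1_lt|yl1_ge] := ltnP (y + l).+1 n; first by rewrite modn_small //; lia.
have -> : (y + l).+1 = n by lia.
by rewrite modnn; lia.
Qed.

Lemma conn_down s y : S s \/ s = n -> ~~ odd y -> y < n -> y < s < y + l ->
  y ~ y + l - 1.
Proof.
move=> Ss y_even y_lt sy.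
have Sy : ~~ S y.
  apply/negP => Sy; have := S_lt Sy; case: Ss => [Ss|]; last by lia.
  by have := S_sep Sy Ss; lia.
apply: connect_trans (connect1 (factor_chord y_lt y_even Sy)) _.
(* [e] is [y + l] reduced modulo [n], and [t] is the removed chord whose interval contains it: [s]
   itself, or [0] after passing [n], the case [s = n]. *)
have [e [t [Ee e_lt St te]]] :
    exists e t, [/\ y + l = e %[mod n], e < n, S t & t < e < t + l].
  have [yl_lt|yl_ge] := ltnP (y + l) n.
    by exists (y + l), s; case: Ss => // Ss; split=> //; lia.
  exists (y + l - n), 0; split=> //; try lia.
  by rewrite -[RHS]modnDr subnK.
have Ee1 : y + l - 1 = e - 1 %[mod n].
  apply/eqP; rewrite -(eqn_modDr 1) !subnK ?Ee //; lia.
rewrite (vtx_congr Ee) (vtx_congr Ee1) -/(e ~ e - 1); apply: conn_sym.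
have E1 : (e - 1).+1 = e by clear -te; lia.
have lt1 : e - 1 < n by clear -E1 e_lt; lia.
rewrite -[in X in connect _ _ X]E1.
apply/connect1/factor_edge; [done|exact: adj_succ|rewrite E1 modn_small //].
have [_ mK _] := mateP lt1; move=> mE; move: mK.
have e_odd : odd e.
  have := congr1 odd Ee; rewrite !odd_mod ?(negPf n_even) // => <-.
  by rewrite oddD (negPf y_even) l_odd.
by rewrite mE (mate_inside St te) e_odd; clear; lia.
Qed.

(** The vertex [s + l] has lost its chord, so both its cycle edges are kept. *)
Lemma conn_end s : S s -> s + l - 1 ~ s + l + 1.
Proof.
move=> Ss; have sl_lt := S_lt Ss; have mE := mate_end Ss.
have E1 : (s + l - 1).+1 = s + l by clear -l_gt1; lia.
have lt1 : s + l - 1 < n by clear -E1 sl_lt; lia.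
apply: (@conn_trans _ (s + l)); apply: connect1.
  rewrite -{2}E1; apply: factor_edge => //; first exact: adj_succ.
  rewrite E1 modn_small // => m1.
  have [_ mK _] := mateP lt1; move: mK.
  by rewrite m1 mE; clear -l_gt1; lia.
rewrite addn1; apply: factor_edge; [done|exact: adj_succ|rewrite mE].
have [lt|ge] := ltnP (s + l).+1 n.
  by rewrite modn_small //; clear; lia.
have E : (s + l).+1 = n by clear -ge sl_lt; lia.
by rewrite E modnn => s0; move: E n_gt2l l_gt1; rewrite s0; clear; lia.
Qed.

(** At most one of the two cycle edges at an odd vertex is removed, and both lead to even vertices;
    hence only even vertices have to be traced. *)
Lemma factor_odd y : y < n -> odd y ->
  exists2 e, ~~ odd e & factor (vtx y) (vtx e).
Proof.
move=> y_lt y_odd; have y1 : (y - 1).+1 = y by clear -y_odd; lia.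
have [mE|mN] := eqVneq (mate y) (y.+1 %% n); last first.
  exists y.+1; first by rewrite /= y_odd.
  by apply: factor_edge => //; [exact: adj_succ|apply/eqP].
exists (y - 1); first by move: y_odd; rewrite -{1}y1.
apply: factor_edge => //; first by rewrite adj_sym -{2}y1; apply: adj_succ.
rewrite mE [RHS]modn_small; last by clear -y_lt; lia.
have [lt|ge] := ltnP y.+1 n; first by rewrite modn_small //; clear; lia.
have E : y.+1 = n by clear -ge y_lt; lia.
by rewrite E modnn => y1_0; move: E n_gt2l l_gt1; rewrite -y1 -y1_0; clear; lia.
Qed.

(** * The hexagon *)

Hypothesis l_gt3 : 3 < l.
Hypothesis S2l : S (2 * l).

Lemma factor_succ x : x.+1 < n -> mate x.+1 <> x -> factor (vtx x) (vtx x.+1).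
Proof.
move=> x_lt mx; have x_lt' := ltnW x_lt.
apply: factor_edge; [done|exact: adj_succ|rewrite modn_small // => E].
by have [_ mK _] := mateP x_lt'; apply: mx; rewrite -E mK.
Qed.

(** In cyclic order: the cycle edges at [l] and [2 * l], both of which have lost their chord, are
    linked by the chords at [l - 1] and [l + 1]. *)
Definition hexagon := [seq vtx x | x <- [:: l - 1; l; l + 1; 2 * l + 1; 2 * l; 2 * l - 1]].

Lemma vtx_hexagon x : x < n ->
  (vtx x \in hexagon) = (x \in [:: l - 1; l; l + 1; 2 * l + 1; 2 * l; 2 * l - 1]).
Proof.
move=> x_lt; apply/mapP/idP => [[y y_in /(congr1 pos)]|x_in]; last by exists x.
have y_lt : y < n.
  have := S_lt S2l; clear -y_in l_gt1; move: y_in; rewrite !inE.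
  by case/or4P => [/eqP|/eqP|/eqP|/or3P[] /eqP] ->; lia.
by rewrite !pos_vtx // => ->.
Qed.

Lemma hexagon_cycle : is_cycle factor hexagon.
Proof.
have l3n := S_lt S2l.
have S1 : ~~ S (l - 1).
  by apply/negP => /(S_sep S0); clear -l_gt1; lia.
have S3 : ~~ S (l + 1).
  by apply/negP => /S_sep/(_ S2l); clear -l_gt1; lia.
have ml : mate l = 0 by have := mate_end S0.
have m2l := mate_start S2l.
have E1 : (l - 1).+1 = l by clear -l_gt1; lia.
have E2 : (2 * l - 1).+1 = 2 * l by clear -l_gt1; lia.
have e1 : factor (vtx (l - 1)) (vtx l).
  by rewrite -{2}E1; apply: factor_succ; rewrite E1 ?ml; clear -l_gt1 l3n; lia.
have e2 : factor (vtx l) (vtx (l + 1)).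
  rewrite addn1; apply: factor_edge; [|exact: adj_succ|];
    by rewrite ?modn_small ?ml; clear -l_gt1 l3n; lia.
have e3 : factor (vtx (l + 1)) (vtx (2 * l + 1)).
  have -> : 2 * l + 1 = l + 1 + l by clear; lia.
  apply: factor_chord => //; first by clear -l_gt1 l3n; lia.
  by rewrite oddD l_odd.
have e4 : factor (vtx (2 * l + 1)) (vtx (2 * l)).
  rewrite factor_sym addn1; apply: factor_edge; [|exact: adj_succ|];
    by rewrite ?modn_small ?m2l; clear -l_gt1 l3n; lia.
have e5 : factor (vtx (2 * l)) (vtx (2 * l - 1)).
  rewrite factor_sym -{2}E2; apply: factor_succ;
    by rewrite E2 ?m2l; clear -l_gt1 l3n; lia.
have e6 : factor (vtx (2 * l - 1)) (vtx (l - 1)).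
  rewrite factor_sym; have -> : 2 * l - 1 = l - 1 + l by clear -l_gt1; lia.
  apply: factor_chord => //; first by clear -l_gt1 l3n; lia.
  by rewrite -[odd _]negbK -[~~ odd (l - 1)]/(odd (l - 1).+1) E1 l_odd.
apply/and3P; split; [by []| |by rewrite /= e1 e2 e3 e4 e5 e6].
rewrite map_inj_in_uniq; first by rewrite /= !inE; clear -l_gt3; lia.
move=> x y xh yh /eqP; rewrite vtx_eq.
by rewrite !modn_small; [move/eqP|move: yh|move: xh]; rewrite ?inE; clear -l_gt3 l3n; lia.
Qed.

Lemma factor_two_cycles :
  (forall y, y < n -> ~~ odd y -> vtx y \notin hexagon -> 2 ~ y) ->
  exists2 c, consists_of_two_cycles factor hexagon c &
    forall v, (v \in c) = (v \notin hexagon).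
Proof.
move=> conn; apply: (two_cycles_of_connect factor_two_factor hexagon_cycle (x0 := vtx 2)).
  by rewrite vtx_hexagon ?inE; clear -l_gt3 n_gt2l; lia.
move=> v; rewrite -(vtx_pos v); set y := pos v; have y_lt := pos_lt v.
have [y_odd|] := boolP (odd y); last by move=> *; apply: conn.
have [e e_even Fye] := factor_odd y_lt y_odd.
rewrite (two_factor_cycle_closed factor_two_factor hexagon_cycle Fye) => e_hex.
have Ee : vtx e = vtx (e %% n) by apply: vtx_congr; rewrite modn_mod.
apply: (@conn_trans _ (e %% n)).
  by apply: conn; rewrite ?ltn_pmod ?odd_mod ?(negPf n_even) // -Ee.
by rewrite -Ee connect1 // factor_sym.
Qed.

(** A removed chord strictly between [a] and [b] would need [a + l < s] and [s + l < b], for which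
    [b <= a + 2 * l] leaves no room. *)
Lemma conn_up_between a b y : S a -> S b -> b <= a + 2 * l -> ~~ odd y ->
  a < y -> y + l <= b -> y ~ y + l + 1.
Proof.
move=> Sa Sb ab y_even ay yb; have b_lt := S_lt Sb.
apply: conn_up => //; first by clear -yb b_lt; lia.
move=> s Ss; have := S_sep Sa Ss; have := S_sep Ss Sb; clear -ab ay yb; lia.
Qed.

(** * Strands *)

Lemma up_to a b y z : S a -> S b -> b <= a + 2 * l -> ~~ odd y ->
  a < y -> y + l <= b -> z = y + l + 1 -> y ~ z.
Proof. by move=> *; subst z; apply: (@conn_up_between a b). Qed.

Lemma down_to s y z : S s \/ s = n -> ~~ odd y -> y < s < y + l ->
  z + 1 = y + l -> y ~ z.
Proof.
move=> Ss y_even ys Ez; have -> : z = y + l - 1 by rewrite -Ez addnK.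
apply: (@conn_down s) => //.
have s_le : s <= n by case: Ss => [/S_lt|->] //; clear; lia.
by clear -ys s_le; lia.
Qed.

(** One upward and one downward move add [(l + 1) + (l - 1) = 2 * l], so the strand keeps its
    number. *)
Lemma hexagon_through p : ~~ odd p -> 0 < p -> p + 2 < l -> p ~ 2 * l + p.
Proof.
move=> p_even p_gt0 p_lt; apply: (@conn_trans _ (p + l + 1)).
  by apply: (@up_to 0 (2 * l)) => //; clear -p_lt; lia.
apply: (@down_to (2 * l)); [by left| |clear -p_lt; lia|clear; lia].
by rewrite !oddD l_odd (negPf p_even).
Qed.

(* An even number s + p with 0 < p <= l - 3 stands for one of the strands that
   pass the chord of s. *)
Section HalfBlock.
Variables s t : nat.
Hypotheses (Ss : S s) (St : S t) (Et : t + 2 = s + 2 * l).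

(** The same two moves add [2 * l], but [t] is only [2 * l - 2] beyond [s]: the number of the strand
    rises by 2. *)
Lemma half_block_through p : ~~ odd p -> 0 < p -> p + 5 <= l ->
  s + p ~ t + p + 2.
Proof.
move=> p_even p_gt0 p_le; have s_even := S_even Ss.
have sp_even : ~~ odd (s + p) by rewrite oddD (negPf s_even) (negPf p_even).
apply: (@conn_trans _ (s + p + l + 1)).
  by apply: (@up_to s t) => //; clear -p_gt0 p_le Et; lia.
apply: (@down_to t); [by left| |clear -Et p_le; lia|clear -Et; lia].
by rewrite !oddD l_odd (negPf s_even) (negPf p_even).
Qed.

(** The strand of [p = l - 3] meets the lower end [t], turns back to [s + l - 1], rounds the upper
    end [s + l] and comes out at [t + 2]. *)
Lemma half_block_last : [/\ s + l - 3 ~ t, s + l - 1 ~ t, s + l - 1 ~ s + l + 1 &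
  s + l + 1 ~ t + 2].
Proof.
have s_even := S_even Ss; split; last 2 first.
- exact: conn_end.
- apply: (@down_to t); [by left| |clear -Et l_gt3; lia|clear -Et; lia].
  by rewrite !oddD l_odd (negPf s_even).
- by apply: (@up_to s t) => //; clear -s_even l_odd Et l_gt3; lia.
- apply: (@down_to t); [by left| |clear -Et l_gt3; lia|clear -Et l_gt1; lia].
  by clear -s_even l_odd l_gt3; lia.
Qed.

Lemma half_block_cover y : ~~ odd y -> s < y -> y + 3 <= t + l ->
  exists p, [/\ ~~ odd p, 0 < p, p + 3 <= l & s + p ~ y].
Proof.
move=> y_even sy yt; have s_even := S_even Ss.
have [c1 c2 c3 c4] := half_block_last.
have q_even : ~~ odd (l - 3) by clear -l_odd l_gt3; lia.
have sl3 : s + (l - 3) = s + l - 3 by clear -l_gt3; lia.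
have last_port z : s + l - 3 ~ z ->
    exists p, [/\ ~~ odd p, 0 < p, p + 3 <= l & s + p ~ z].
  by move=> c; exists (l - 3); split; [|clear -l_gt3; lia|clear -l_gt3; lia|rewrite sl3].
have [y1|y1] := leqP (y + 3) (s + l).
  exists (y - s); rewrite subnKC; last exact: ltnW.
  split; last exact: connect0.
  - by clear -sy y_even s_even; lia.
  - by clear -sy; lia.
  - by clear -y1 sy; lia.
have [->|y2] := eqVneq y (s + l - 1).
  by apply: last_port; apply: conn_trans c1 (conn_sym c2).
have [->|y3] := eqVneq y (s + l + 1).
  by apply: last_port; apply: conn_trans c1 (conn_trans (conn_sym c2) c3).
have [y4|y4] := leqP y t.
  exists (y - s - l - 1).
  have Ey : y = s + (y - s - l - 1) + l + 1.
    by clear -y1 y2 y3 l_odd y_even s_even; lia.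
  have p_even : ~~ odd (y - s - l - 1) by clear -Ey l_odd y_even s_even; lia.
  have p_gt0 : 0 < y - s - l - 1 by clear -Ey y1 y2 y3; lia.
  split=> //; first by clear -Ey y4 Et; lia.
  apply: (@up_to s t) => //.
  - by clear -Et; lia.
  - by rewrite oddD (negPf s_even).
  - by clear -p_gt0; lia.
  - by clear -Ey y4 Et; lia.
have t_even := S_even St.
have [->|y5] := eqVneq y (t + 2).
  by apply: last_port; apply: conn_trans c1 (conn_trans (conn_sym c2) (conn_trans c3 c4)).
exists (y - t - 2).
have Ey : y = t + (y - t - 2) + 2 by clear -y4 y5 y_even t_even; lia.
have p_even : ~~ odd (y - t - 2) by clear -Ey y_even t_even; lia.
have p_gt0 : 0 < y - t - 2 by clear -Ey y5; lia.
split=> //; first by clear -Ey yt; lia.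
by rewrite {2}Ey; apply: half_block_through => //; clear -Ey yt; lia.
Qed.

End HalfBlock.

(* The relation e_i e_j e_i = e_i: past the chords of s, t and r, every strand is
   where it was past the chord of s. *)
Section Block.
Variables s t r : nat.
Hypotheses (Ss : S s) (St : S t) (Sr : S r).
Hypotheses (Et : t + 2 = s + 2 * l) (Er : r = t + l + 1).

Lemma block_step y z : ~~ odd y -> t + 1 < y -> y < r -> z + 1 = y + l -> y ~ z.
Proof.
by move=> y_even ty yr Ez; apply: (@down_to r) => //; [left|clear -Er ty yr; lia].
Qed.

(** The turning strand goes on from [t + 2] to [r], rounds the upper end [t + l] and regains its
    number [l - 3]. *)
Lemma block_last : [/\ t + 2 ~ r, r ~ t + l - 1 & t + l - 1 ~ r + l - 3].
Proof.
have t_even := S_even St; split.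
- apply: block_step; [by rewrite oddD (negPf t_even)|clear; lia|clear -Er l_gt3; lia|].
  by rewrite Er; clear; lia.
- by rewrite Er; apply/conn_sym/conn_end.
- apply: block_step; [|clear -l_gt3; lia|clear -Er l_gt3; lia|clear -Er l_gt3; lia].
  by clear -t_even l_odd l_gt3; lia.
Qed.

(** For [p + 5 <= l] the downward move to [r + p] takes back the rise by 2; the remaining case
    [p = l - 3] is the turning strand. *)
Lemma block_through p : ~~ odd p -> 0 < p -> p + 3 <= l -> s + p ~ r + p.
Proof.
move=> p_even p_gt0 p_le; have [p5|p5] := leqP (p + 5) l.
  apply: conn_trans (half_block_through Ss St Et p_even p_gt0 p5) _.
  apply: block_step; rewrite ?Er.
  - by rewrite !oddD (negPf (S_even St)) (negPf p_even).
  - by clear -p_gt0; lia.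
  - by clear -p5; lia.
  - by clear; lia.
have El : l = p + 3 by clear -p_even l_odd p5 p_le; lia.
have [c1 c2 c3 c4] := half_block_last Ss St Et.
have [d1 d2 d3] := block_last.
have -> : s + p = s + l - 3 by rewrite El; clear; lia.
have -> : r + p = r + l - 3 by rewrite El; clear; lia.
apply: conn_trans c1 (conn_trans (conn_sym c2) (conn_trans c3 (conn_trans c4 _))).
exact: conn_trans d1 (conn_trans d2 d3).
Qed.

Lemma block_cover y : ~~ odd y -> s < y -> y <= r ->
  exists p, [/\ ~~ odd p, 0 < p, p + 3 <= l & s + p ~ y].
Proof.
move=> y_even sy yr; have [yt|yt] := leqP (y + 3) (t + l).
  exact: (half_block_cover Ss St Et).
have t_even := S_even St.
have [d1 d2 d3] := block_last.
have ry : r ~ y.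
  have [->|yN] := eqVneq y r; first exact: connect0.
  have -> // : y = t + l - 1.
  by clear -yN Er yt yr t_even y_even l_odd; lia.
have [p [p_even p_gt0 p_le c]] : exists p, [/\ ~~ odd p, 0 < p, p + 3 <= l & s + p ~ t + 2].
  apply: (half_block_cover Ss St Et); first by rewrite oddD (negPf t_even).
    by clear -Et l_gt3; lia.
  by clear -l_gt3 l_odd; lia.
by exists p; split=> //; apply: conn_trans c (conn_trans d1 ry).
Qed.

End Block.

(** * Beyond the last removed chord *)

(** With no removed chord left above, upward moves by [l + 1] can be repeated; this is why [n] may
    grow by multiples of [l + 1]. *)
Lemma climb t y m z : (forall s, S s -> s <= t) -> ~~ odd y -> t < y ->
  z = y + m * (l + 1) -> z <= n -> y ~ z.
Proof.
move=> S_le y_even ty -> {z}; elim: m => [|m IHm] z_le; first by rewrite addn0.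
apply: conn_trans (IHm _) _; first by clear -z_le; lia.
have -> : y + m.+1 * (l + 1) = y + m * (l + 1) + l + 1 by clear; lia.
apply: conn_up.
- by rewrite oddD oddM oddD l_odd (negPf y_even) andbF.
- by clear -z_le; lia.
- by move=> s /S_le; clear -ty; lia.
Qed.

Lemma climb_cover t y : (forall s, S s -> s <= t) -> ~~ odd t -> ~~ odd y ->
  t < y -> y <= n -> exists x, [/\ ~~ odd x, t < x, x <= t + l + 1 & x ~ y].
Proof.
move=> S_le t_even y_even ty yn.
(* The window [t + 1, ..., t + l + 1] holds one representative modulo [l + 1]; the successor keeps
   [x] above [t]. *)
pose x := t + ((y - t - 1) %% (l + 1)).+1.
have Ey : y = x + (y - t - 1) %/ (l + 1) * (l + 1).
  by have := divn_eq (y - t - 1) (l + 1); rewrite /x; clear -ty; lia.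
have x_even : ~~ odd x.
  by move: y_even; rewrite {1}Ey oddD oddM oddD l_odd andbF addbF.
exists x; split=> //.
- by rewrite /x; clear; lia.
- have := ltn_pmod (y - t - 1) (d := l + 1) ltac:(clear; lia).
  by rewrite /x; clear; lia.
- by apply: (climb S_le x_even _ Ey yn); rewrite /x; clear; lia.
Qed.

Lemma all_ports : (forall p, ~~ odd p -> 0 < p -> p + 5 <= l -> p ~ p + 2) ->
  forall p, ~~ odd p -> 0 < p -> p + 3 <= l -> 2 ~ p.
Proof.
move=> step p; have [k] := ubnP p; elim: k p => // k IHk p pk p_even p_gt0 p_le.
have [->|p2] := eqVneq p 2; first exact: connect0.
have Ep : p = p - 2 + 2 by clear -p_even p_gt0; lia.
have q_even : ~~ odd (p - 2) by clear -p_even Ep; lia.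
have q_gt0 : 0 < p - 2 by clear -p2 Ep; lia.
apply: conn_trans (IHk (p - 2) _ q_even q_gt0 _) _.
- by clear -pk Ep; lia.
- by clear -p_le Ep; lia.
- by rewrite [in X in connect _ _ (vtx X)]Ep; apply: step => //; clear -p_le Ep; lia.
Qed.

(** * Closing the strands around the cycle *)

Section Final.
Variable s : nat.
Hypotheses (Ss : S s).
Hypothesis through : forall p, ~~ odd p -> 0 < p -> p + 3 <= l -> p ~ s + p.

(** A downward move into the interval of the chord at [0], read as a chord at [n]. *)
Lemma conn_wrap x p : ~~ odd p -> p + 3 <= l -> x + l = n + p + 1 -> x ~ p.
Proof.
move=> p_even p_le Ex; rewrite -(vtxDn p).
apply: (@down_to n); [by right| | |].
- have := congr1 odd Ex; rewrite !oddD l_odd (negPf n_even) (negPf p_even) /=.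
  by case: odd.
- by clear -Ex p_le; lia.
- by rewrite Ex; clear; lia.
Qed.

Let s_even := S_even Ss.

(** One turn carries [p + 2] to [s + p + 2] and then, by [wrap], to [p]: neighbouring strands are
    joined, and a single cycle contains them all. *)
Lemma final_even b : (forall x, S x -> x <= s) -> n = s + b.+1 * (l + 1) ->
  (forall p, ~~ odd p -> 0 < p -> p + 3 <= l -> 2 ~ p) /\
  forall y, ~~ odd y -> s < y -> y <= n -> 2 ~ y.
Proof.
move=> S_le En.
have wrap p : ~~ odd p -> p + 3 <= l -> s + p + 2 ~ p.
  move=> p_even p_le; apply: (@conn_trans _ (s + p + 2 + b * (l + 1))).
    apply: (climb S_le) => //; last by rewrite En; clear -p_le; lia.
      by rewrite !oddD (negPf s_even) (negPf p_even).
    by clear; lia.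
  by apply: conn_wrap => //; rewrite En; clear; lia.
have ports p : ~~ odd p -> 0 < p -> p + 3 <= l -> 2 ~ p.
  apply: all_ports => {}p p_even p_gt0 p_le; apply: conn_sym.
  apply: conn_trans (through _ _ _) _; first by rewrite oddD (negPf p_even).
  - by clear; lia.
  - by clear -p_le; lia.
  - by rewrite addnA; apply: wrap => //; clear -p_le; lia.
split=> // y y_even sy yn.
have [x [x_even sx xl xy]] := climb_cover S_le s_even y_even sy yn.
apply: conn_trans xy.
have [x3|x3] := leqP (x + 3) (s + l).
  have p_even : ~~ odd (x - s) by clear -s_even x_even; lia.
  have p_gt0 : 0 < x - s by clear -sx; lia.
  have p_le : x - s + 3 <= l by clear -sx x3; lia.
  apply: conn_trans (ports _ p_even p_gt0 p_le) _.
  by have := through p_even p_gt0 p_le; rewrite subnKC // ltnW.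
have l3_even : ~~ odd (l - 3) by clear -l_odd l_gt3; lia.
have last_conn : 2 ~ s + l - 1.
  apply: conn_trans (ports (l - 3) l3_even _ _) (conn_sym _).
  - by clear -l_gt3; lia.
  - by clear -l_gt3; lia.
  have -> : s + l - 1 = s + (l - 3) + 2 by clear -l_gt3; lia.
  by apply: wrap => //; clear -l_gt3; lia.
have [->//|xN] := eqVneq x (s + l - 1).
have -> : x = s + l + 1 by clear -l_odd s_even x_even xN xl x3; lia.
exact: conn_trans last_conn (conn_end Ss).
Qed.

(** The passage from [s] to [t] raises the number by 2 and [wrap] lowers it by 4, so one turn again
    lowers it by 2, except for the turning strand. *)
Lemma final_odd t b : S t -> (forall x, S x -> x <= t) -> t + 2 = s + 2 * l ->
  n = t + b * (l + 1) + l + 3 ->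
  (forall p, ~~ odd p -> 0 < p -> p + 3 <= l -> 2 ~ p) /\
  forall y, ~~ odd y -> s < y -> y <= n -> 2 ~ y.
Proof.
move=> St S_le Et En; have t_even := S_even St.
have wrap p : ~~ odd p -> p + 3 <= l -> t + p + 4 ~ p.
  move=> p_even p_le; apply: (@conn_trans _ (t + p + 4 + b * (l + 1))).
    apply: (climb S_le) => //; last by rewrite En; clear -p_le; lia.
      by rewrite !oddD (negPf t_even) (negPf p_even).
    by clear; lia.
  by apply: conn_wrap => //; rewrite En; clear; lia.
have [c1 c2 c3 c4] := half_block_last Ss St Et.
have l3_even : ~~ odd (l - 3) by clear -l_odd l_gt3; lia.
have l5_even : ~~ odd (l - 5) by clear -l_odd l_gt3; lia.
have l5 : 5 <= l by clear -l_odd l_gt3; lia.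
have t_end : t + l + 1 ~ l - 3.
  have -> : t + l + 1 = t + (l - 3) + 4 by clear -l5; lia.
  by apply: wrap => //; clear -l5; lia.
have t_end' : t + l - 1 ~ l - 3 := conn_trans (conn_end St) t_end.
have ports p : ~~ odd p -> 0 < p -> p + 3 <= l -> 2 ~ p.
  apply: all_ports => {}p p_even p_gt0 p_le.
  have [p7|p7] := leqP (p + 7) l.
    apply: conn_sym; apply: conn_trans (through (p := p + 2) _ _ _) _.
    - by rewrite oddD (negPf p_even).
    - by clear; lia.
    - by clear -p_le; lia.
    apply: conn_trans (half_block_through Ss St Et (p := p + 2) _ _ _) _.
    - by rewrite oddD (negPf p_even).
    - by clear; lia.
    - by clear -p7; lia.
    have -> : t + (p + 2) + 2 = t + p + 4 by clear; lia.
    by apply: wrap => //; clear -p_le; lia.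
  (* Now [p + 2 = l - 3] is the turning strand; it is joined to [p] around the upper end [t + l] of
     the last chord instead. *)
  have Ep : l = p + 5 by clear -p7 p_le p_even l_odd; lia.
  have -> : p + 2 = l - 3 by rewrite Ep; clear; lia.
  apply: conn_trans t_end'; have -> : t + l - 1 = t + p + 4 by rewrite Ep; clear; lia.
  by apply/conn_sym/wrap => //; clear -p_le; lia.
split=> // y y_even sy yn.
have port_conn x : s < x -> ~~ odd x -> x + 3 <= t + l -> 2 ~ x.
  move=> sx x_even x_le.
  have [p [p_even p_gt0 p_le c]] := half_block_cover Ss St Et x_even sx x_le.
  exact: conn_trans (ports p p_even p_gt0 p_le) (conn_trans (through p_even p_gt0 p_le) c).
have l3_conn : 2 ~ l - 3 by apply: ports => //; clear -l5; lia.
have [y3|y3] := leqP (y + 3) (t + l); first exact: port_conn.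
have ty : t < y by clear -y3 l5; lia.
have [x [x_even tx xl xy]] := climb_cover S_le t_even y_even ty yn.
apply: conn_trans xy.
have [x3|x3] := leqP (x + 3) (t + l).
  by apply: port_conn => //; clear -tx Et l5; lia.
apply: conn_trans l3_conn (conn_sym _).
have [->//|xN] := eqVneq x (t + l - 1).
have -> // : x = t + l + 1 by clear -l_odd t_even x_even xN xl x3; lia.
Qed.

End Final.

(** * Chains of blocks *)

(** Neither the hexagon nor a block changes the number of a strand; a block has length
    [(2 * l - 2) + (l + 1) = 3 * l - 1]. *)
Lemma chain_through k :
  (forall q, q <= k -> S (2 * l + q * (3 * l - 1))) ->
  (forall q, q < k -> S (2 * l + q * (3 * l - 1) + 2 * l - 2)) ->
  forall p, ~~ odd p -> 0 < p -> p + 3 <= l -> p ~ 2 * l + k * (3 * l - 1) + p.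
Proof.
elim: k => [|k IHk] S1 S2 p p_even p_gt0 p_le.
  by rewrite addn0; apply: hexagon_through => //; clear -p_le; lia.
apply: conn_trans (IHk _ _ p p_even p_gt0 p_le) _.
- by move=> q qk; apply: S1; apply: leqW.
- by move=> q qk; apply: S2; apply: ltnW.
apply: (@block_through _ (2 * l + k * (3 * l - 1) + 2 * l - 2)) => //.
- exact/S1/leqnSn.
- exact: S2.
- exact: S1.
- by move: (k * _); clear -l_gt1; lia.
- by rewrite [k.+1 * _]mulSn; move: (k * _); clear -l_gt1; lia.
Qed.

Lemma chain_cover k :
  (forall q, q <= k -> S (2 * l + q * (3 * l - 1))) ->
  (forall q, q < k -> S (2 * l + q * (3 * l - 1) + 2 * l - 2)) ->
  forall y, ~~ odd y -> 0 < y -> y <= 2 * l + k * (3 * l - 1) ->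
  vtx y \notin hexagon -> exists p, [/\ ~~ odd p, 0 < p, p + 3 <= l & p ~ y].
Proof.
elim: k => [|k IHk] S1 S2 y y_even y_gt0.
  rewrite addn0 => y_le.
  rewrite vtx_hexagon ?inE; last by clear -y_le n_gt2l; lia.
  rewrite !negb_or => /and4P[y1 _ y2 /and3P[_ y3 _]].
  have [yl|yl] := leqP (y + 3) l; first by exists y; split=> //; apply: connect0.
  have Ey : y = y - l - 1 + l + 1 by clear -yl y1 y2 l_odd y_even; lia.
  have p_even : ~~ odd (y - l - 1) by clear -Ey l_odd y_even; lia.
  have p_gt0 : 0 < y - l - 1 by clear -yl y1 y2 Ey y_even l_odd; lia.
  exists (y - l - 1); split=> //.
    by clear -Ey y_le y3 y_even l_odd; lia.
  by apply: (@up_to 0 (2 * l)) => //; clear -Ey y_le y3 y_even l_odd; lia.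
move=> y_le y_hex.
have S1' q : q <= k -> S (2 * l + q * (3 * l - 1)) by move=> qk; apply: S1; apply: leqW.
have S2' q : q < k -> S (2 * l + q * (3 * l - 1) + 2 * l - 2).
  by move=> qk; apply: S2; apply: ltnW.
have [yk|yk] := leqP y (2 * l + k * (3 * l - 1)); first exact: IHk.
have [p [p_even p_gt0 p_le c]] : exists p, [/\ ~~ odd p, 0 < p, p + 3 <= l &
    2 * l + k * (3 * l - 1) + p ~ y].
  apply: (@block_cover _ (2 * l + k * (3 * l - 1) + 2 * l - 2)
                         (2 * l + k.+1 * (3 * l - 1))) => //.
  - exact: S1'.
  - exact: S2.
  - exact: S1.
  - by move: (k * _); clear -l_gt1; lia.
  - by rewrite [k.+1 * _]mulSn; move: (k * _); clear -l_gt1; lia.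
exists p; split=> //.
exact: conn_trans (chain_through S1' S2' p_even p_gt0 p_le) c.
Qed.

Lemma chain_conn k :
  (forall q, q <= k -> S (2 * l + q * (3 * l - 1))) ->
  (forall q, q < k -> S (2 * l + q * (3 * l - 1) + 2 * l - 2)) ->
  ((forall p, ~~ odd p -> 0 < p -> p + 3 <= l -> 2 ~ p) /\
   forall y, ~~ odd y -> 2 * l + k * (3 * l - 1) < y -> y <= n -> 2 ~ y) ->
  forall y, y < n -> ~~ odd y -> vtx y \notin hexagon -> 2 ~ y.
Proof.
move=> S1 S2 [ports beyond] y y_lt y_even y_hex.
have [y0|y_gt0] := posnP y.
  (* Vertex [0] is treated as [n], the end of the last stretch. *)
  rewrite y0 -(vtxDn 0); apply: beyond => //.
  by have := S_lt (S1 k (leqnn k)); clear; lia.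
have [yk|yk] := leqP y (2 * l + k * (3 * l - 1)); last exact: beyond _ (ltnW y_lt).
have [p [p_even p_gt0 p_le c]] := chain_cover S1 S2 y_even y_gt0 yk y_hex.
exact: conn_trans (ports p p_even p_gt0 p_le) c.
Qed.

End Coordinates.

(** * The removed chords *)

(* The chords 0, s_0, t_0, s_1, t_1, ... with s_q = 2 l + q (3 l - 1) and
   t_q = s_q + 2 l - 2, ending with s_k if k' = k and with t_k if k' = k + 1. *)
Definition removed l k k' : pred nat := fun s =>
  [|| s == 0, has (fun q => s == 2 * l + q * (3 * l - 1)) (iota 0 k.+1)
    | has (fun q => s == 2 * l + q * (3 * l - 1) + 2 * l - 2) (iota 0 k')].

Lemma removedP l k k' s : reflect
  [\/ s = 0, exists2 q, q <= k & s = 2 * l + q * (3 * l - 1)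
    | exists2 q, q < k' & s = 2 * l + q * (3 * l - 1) + 2 * l - 2]
  (removed l k k' s).
Proof.
apply: (iffP or3P) => [] [].
- by move=> /eqP; apply: Or31.
- by case/hasP => q; rewrite mem_iota => qk /eqP E; apply: Or32; exists q.
- by case/hasP => q; rewrite mem_iota => qk /eqP E; apply: Or33; exists q.
- by move=> ->; apply: Or31.
- by case=> q qk ->; apply: Or32; apply/hasP; exists q; rewrite ?mem_iota.
- by case=> q qk ->; apply: Or33; apply/hasP; exists q; rewrite ?mem_iota.
Qed.

Lemma removed_even l k k' s : odd l -> removed l k k' s -> ~~ odd s.
Proof.
move=> l_odd; have P_even : ~~ odd (3 * l - 1) by lia.
have qP_even q : ~~ odd (q * (3 * l - 1)) by rewrite oddM (negPf P_even) andbF.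
by case/removedP => [->//|[q _ ->]|[q _ ->]]; have := qP_even q;
  move: (q * _); clear -l_odd; lia.
Qed.

(** Successive chords are [2 * l], [2 * l - 2] or [l + 1] apart, each more than [l]. *)
Lemma removed_sep l k k' s t : 3 < l -> removed l k k' s -> removed l k k' t ->
  s < t -> s + l < t.
Proof.
move=> l_gt3.
have mono q q' : q < q' -> q * (3 * l - 1) + 3 * l <= q' * (3 * l - 1) + 1.
  move=> qq'; have: q.+1 * (3 * l - 1) <= q' * (3 * l - 1) by rewrite leq_mul2r qq' orbT.
  by rewrite [q.+1 * _]mulSn; move: (q * _) (q' * _); clear -l_gt3; lia.
case/removedP => [->|[q _ ->]|[q _ ->]]; case/removedP => [->|[q' _ ->]|[q' _ ->]];
  try (case: (ltngtP q q') => [/mono|/mono|->]); try move: (q * _); try move: (q' * _);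
  clear -l_gt3; lia.
Qed.

Lemma removed_leq l k k' s : 3 < l -> k' <= k -> removed l k k' s ->
  s <= 2 * l + k * (3 * l - 1).
Proof.
move=> l_gt3 kk'.
have mono q : q < k -> q * (3 * l - 1) + 3 * l <= k * (3 * l - 1) + 1.
  move=> qk; have: q.+1 * (3 * l - 1) <= k * (3 * l - 1) by rewrite leq_mul2r qk orbT.
  by rewrite [q.+1 * _]mulSn; move: (q * _) (k * _); clear -l_gt3; lia.
case/removedP => [->//|[q qk ->]|[q qk ->]].
  by rewrite leq_add2l leq_mul2r qk orbT.
by have := mono q (leq_trans qk kk'); move: (q * _) (k * _); clear -l_gt3; lia.
Qed.

Lemma removed_leqS l k s : 3 < l -> removed l k k.+1 s ->
  s <= 2 * l + k * (3 * l - 1) + 2 * l - 2.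
Proof.
move=> l_gt3.
have mono q : q <= k -> q * (3 * l - 1) <= k * (3 * l - 1).
  by move=> qk; rewrite leq_mul2r qk orbT.
case/removedP => [->//|[q /mono + ->]|[q /mono + ->]];
  by move: (q * _) (k * _); clear -l_gt3; lia.
Qed.

(** * Separating two vertices by a rotated hexagon *)

Section Separation.
Variables l n : nat.
Hypotheses (l_gt3 : 3 < l) (l_odd : odd l) (n_even : ~~ odd n) (n_gt : 3 * l < n).

Let hex := [:: l - 1; l; l + 1; 2 * l + 1; 2 * l; 2 * l - 1].

(** Adding [a + n - y] is the rotation that takes [y] to [a]; it has to be odd to serve as the
    offset [j] of [vtx]. *)
Let good a b y := all (fun z => (z + (a + n - y)) %% n != b) hex.

Lemma not_good a b d y : a < n -> b < n -> b + n = a + d \/ b = a + d -> d < n ->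
  y \in hex -> ~~ good a b y -> exists2 z, z \in hex & z = y + d \/ z + n = y + d.
Proof.
move=> a_lt b_lt ab d_lt y_hex /allPn[z z_hex]; rewrite negbK => /eqP zb.
have hex_lt x : x \in hex -> x < n.
  by rewrite !inE; clear -l_gt3 n_gt; lia.
have z_lt := hex_lt z z_hex; have y_lt := hex_lt y y_hex.
have : z = y + d %[mod n].
  apply/eqP; rewrite -(eqn_modDr (a + n - y)) zb -{1}(modn_small b_lt).
  have -> : y + d + (a + n - y) = a + d + n by clear -y_lt; lia.
  by case: ab => <-; rewrite !modnDr.
rewrite (modn_small z_lt) => Ez; exists z => //.
have [yd_lt|yd_ge] := ltnP (y + d) n; first by left; rewrite Ez modn_small.
right; rewrite Ez.
have -> : y + d = y + d - n + n by clear -yd_ge; lia.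
by rewrite modnDr modn_small //; clear -y_lt d_lt; lia.
Qed.

(* For l = 3 this fails: the rotation by 1 maps the three even vertices of the
   hexagon to its three odd ones. *)
Lemma hexagon_separates a b : a < n -> b < n -> a != b ->
  exists2 y, y \in hex & odd (a + n - y) && good a b y.
Proof.
move=> a_lt b_lt ab.
have [d [dE d_gt0 d_lt]] : exists d, [/\ b + n = a + d \/ b = a + d, 0 < d & d < n].
  have [ltab|leba] := ltnP a b; first by exists (b - a); split; clear -ltab b_lt; lia.
  by exists (b + n - a); split; move: ab; clear -leba a_lt; lia.
have bad y : y \in hex -> odd (a + n - y) -> good a b y \/
    exists2 z, z \in hex & z = y + d \/ z + n = y + d.
  move=> y_hex y_odd; have [g|ng] := boolP (good a b y); first by left.
  by right; apply: (not_good a_lt b_lt dE d_lt y_hex ng).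
have found y : y \in hex -> odd (a + n - y) -> good a b y ->
    exists2 y, y \in hex & odd (a + n - y) && good a b y.
  by move=> y_hex y_odd g; exists y => //; rewrite y_odd.
(* The offset is odd when [y] and [a] differ in parity, which leaves three choices of [y]. If all
   fail, the first two force [d = l] for odd [a] and [d = 1] for even [a], and the third then leaves
   the hexagon. *)
have [a_odd|a_even] := boolP (odd a).
  have h1 : l - 1 \in hex by rewrite !inE eqxx.
  have h2 : l + 1 \in hex by rewrite !inE eqxx !orbT.
  have h3 : 2 * l \in hex by rewrite !inE eqxx !orbT.
  have o1 : odd (a + n - (l - 1)) by clear -a_odd n_even l_odd n_gt; lia.
  have o2 : odd (a + n - (l + 1)) by clear -a_odd n_even l_odd n_gt; lia.
  have o3 : odd (a + n - 2 * l) by clear -a_odd n_even l_odd n_gt; lia.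
  case: (bad _ h1 o1) => [g|[z1 z1h E1]]; first exact: (found _ h1).
  case: (bad _ h2 o2) => [g|[z2 z2h E2]]; first exact: (found _ h2).
  case: (bad _ h3 o3) => [g|[z3 z3h E3]]; first exact: (found _ h3).
  exfalso.
  have d1 : d \in [:: 1; 2; l; l + 1; l + 2].
    by move: z1h; rewrite !inE; clear -E1 d_gt0 d_lt l_gt3 n_gt; lia.
  have d2 : d \in [:: n - 2; n - 1; l; l - 1; l - 2].
    by move: z2h; rewrite !inE; clear -E2 d_gt0 d_lt l_gt3 n_gt; lia.
  have dl : d = l.
    by move: d1 d2; rewrite !inE; clear -l_odd l_gt3 n_gt; lia.
  by move: z3h E3; rewrite dl !inE; clear -l_gt3 n_gt; lia.
have h1 : l \in hex by rewrite !inE eqxx !orbT.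
have h2 : 2 * l - 1 \in hex by rewrite !inE eqxx !orbT.
have h3 : 2 * l + 1 \in hex by rewrite !inE eqxx !orbT.
have o1 : odd (a + n - l) by clear -a_even n_even l_odd n_gt; lia.
have o2 : odd (a + n - (2 * l - 1)) by clear -a_even n_even l_odd n_gt; lia.
have o3 : odd (a + n - (2 * l + 1)) by clear -a_even n_even l_odd n_gt; lia.
case: (bad _ h1 o1) => [g|[z1 z1h E1]]; first exact: (found _ h1).
case: (bad _ h2 o2) => [g|[z2 z2h E2]]; first exact: (found _ h2).
case: (bad _ h3 o3) => [g|[z3 z3h E3]]; first exact: (found _ h3).
exfalso.
have d1 : d \in [:: n - 1; 1; l + 1; l; l - 1].
  by move: z1h; rewrite !inE; clear -E1 d_gt0 d_lt l_gt3 n_gt; lia.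
have d2 : d \in [:: n - l; n - (l - 1); n - (l - 2); 1; 2].
  by move: z2h; rewrite !inE; clear -E2 d_gt0 d_lt l_gt3 n_gt; lia.
have dl : d = 1.
  by move: d1 d2; rewrite !inE; clear -l_odd l_gt3 n_gt; lia.
by move: z3h E3; rewrite dl !inE; clear -l_gt3 n_gt; lia.
Qed.

End Separation.

(** * Assembling the 2-factor *)

Section HexagonFactor.
Variables l n j k k' : nat.
Hypotheses (l_odd : odd l) (l_gt3 : 3 < l) (n_even : ~~ odd n).
Hypotheses (n_gt2l : 2 * l < n) (j_odd : odd j).

Let l_gt1 : 1 < l := ltn_trans (isT : 1 < 3) l_gt3.
Let R := removed l k k'.
Let R_even s : R s -> ~~ odd s. Proof. exact: removed_even. Qed.
Let R_sep s t : R s -> R t -> s < t -> s + l < t. Proof. exact: removed_sep. Qed.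

(** The chain ends with [s_k] in the first case and with the extra chord [t_k] in the second. *)
Lemma hexagon_factor b :
  (k' = k /\ n = 2 * l + k * (3 * l - 1) + b.+1 * (l + 1)) \/
  (k' = k.+1 /\
   n = 2 * l + k * (3 * l - 1) + 2 * l - 2 + b * (l + 1) + l + 3) ->
  exists2 F, two_factor F &
  exists2 c, consists_of_two_cycles F (hexagon j n_gt2l) c &
    forall v, (v \in c) = (v \notin hexagon j n_gt2l).
Proof.
move=> cases; have R0 : R 0 by [].
have R1 q : q <= k -> R (2 * l + q * (3 * l - 1)).
  by move=> qk; apply/removedP/Or32; exists q.
have R2 q : q < k' -> R (2 * l + q * (3 * l - 1) + 2 * l - 2).
  by move=> qk; apply/removedP/Or33; exists q.
have kk' : k <= k' by case: cases => -[-> _].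
have R2l : R (2 * l) by have := R1 0 (leq0n k); rewrite addn0.
have R_lt s : R s -> s + l < n.
  rewrite /R; case: cases => -[-> ->].
    by move=> /(removed_leq l_gt3 (leqnn k)); move: (k * _); clear -l_gt3; lia.
  by move=> /(removed_leqS l_gt3); move: (k * _); clear -l_gt3; lia.
have R2' q : q < k -> R (2 * l + q * (3 * l - 1) + 2 * l - 2).
  by move=> qk; apply/R2/(leq_trans qk).
have F_factor := factor_two_factor l_odd l_gt1 n_even n_gt2l j_odd R0 R_even R_lt R_sep.
exists (factor j n_gt2l R) => //.
apply: factor_two_cycles => //.
apply: (@chain_conn _ _ _ _ _ _ _ _ R _ _ _ _ _ _ k) => //.
have through := chain_through l_odd l_gt1 n_even n_gt2l j_odd R0 R_even R_lt R_sep l_gt3 R2l R1 R2'.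
case: cases => -[Ek En].
  apply: (@final_even _ _ _ _ _ _ _ _ R _ _ _ _ _ _ _ through b) => //.
  - exact: R1.
  - by move=> s; rewrite /R Ek; apply: removed_leq.
apply: (@final_odd _ _ _ _ _ _ _ _ R _ _ _ _ _ _ _ through
         (2 * l + k * (3 * l - 1) + 2 * l - 2) b) => //.
- exact: R1.
- by apply: R2; rewrite Ek.
- by move=> s; rewrite /R Ek; apply: removed_leqS.
- by move: (k * _); clear -l_gt3; lia.
Qed.

End HexagonFactor.

Theorem theorem2p5 (l n alpha : nat) :
  3 < l -> odd l ->
  n = 2 * l + alpha -> 0 < alpha ->
  (exists beta gamma : nat,
     alpha = beta * (l + 1) + gamma * (3 * l + 1)) ->
  two_spanning_cyclable (HTG 1 n l).
Proof.
move=> l_gt3 l_odd En alpha_gt0 [beta [gamma Ea]].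
have n_even : ~~ odd n.
  by rewrite En Ea !oddD !oddM !oddD l_odd /= !andbF.
have alpha_gt : l < alpha.
  rewrite Ea; move: alpha_gt0; rewrite Ea.
  case: (beta) => [|b]; case: (gamma) => [|g] //= _; rewrite ?mulSn; clear; lia.
have n_gt2l : 2 * l < n by rewrite En -[ltnLHS]addn0 ltn_add2l.
have n_gt3l : 3 * l < n by rewrite En; clear -alpha_gt; lia.
have n_gt0 : 0 < n := leq_ltn_trans (leq0n _) n_gt2l.
have l_gt1 : 1 < l := ltn_trans (isT : 1 < 3) l_gt3.
move=> u v uv.
have uv2 : u.2 != v.2 :> nat.
  by apply: contraNneq uv => /val_inj E; case: u v E => [i a] [i' b] /= ->; rewrite !ord1.
have [y y_hex /andP[j_odd /allP good]] :=
  hexagon_separates l_gt3 l_odd n_even n_gt3l (ltn_ord u.2) (ltn_ord v.2) uv2.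
set j := u.2 + n - y in j_odd good.
pose k := gamma./2.
have [k' [b H]] : exists k' b,
  (k' = k /\ n = 2 * l + k * (3 * l - 1) + b.+1 * (l + 1)) \/
  (k' = k.+1 /\ n = 2 * l + k * (3 * l - 1) + 2 * l - 2 + b * (l + 1) + l + 3).
  have Eg := odd_double_half gamma; rewrite -/k in Eg.
  (* Two terms [3 * l + 1] make up one block of length [3 * l - 1] and three steps of [l + 1]. *)
  have E3 : 2 * (k * (3 * l + 1)) = k * (3 * l - 1) + 3 * k * (l + 1).
    have -> : 3 * l + 1 = 3 * l - 1 + 2 by clear -l_gt1; lia.
    have -> : 3 * k * (l + 1) = k * (3 * l - 1 + 4).
      have -> : 3 * l - 1 + 4 = 3 * (l + 1) by clear -l_gt1; lia.
      by rewrite mulnCA mulnA.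
    by rewrite !mulnDr; clear; lia.
  case g_odd : (odd gamma) Eg => Eg.
    (* The odd term splits as [3 * l + 1 = (2 * l - 2) + (l + 3)], the room for the chord [t_k]. *)
    exists k.+1, (beta + 3 * k); right; split=> //.
    rewrite En Ea -Eg mulnDl -[k.*2]mul2n -mulnA E3 mulnDl.
    by move: (k * _) (beta * _) (3 * k * _) => A B C; clear -l_gt1; lia.
  (* The predecessor is harmless: [alpha > 0] excludes [beta = k = 0]. *)
  exists k, (beta + 3 * k).-1; left; split=> //.
  rewrite prednK; last first.
    move: alpha_gt0; rewrite Ea -Eg -mul2n; case: (beta) => //; case: (k) => //.
  rewrite En Ea -Eg add0n -mul2n -mulnA E3 mulnDl.
  by move: (k * _) (beta * _) (3 * k * _) => A B C; clear; lia.
have [F F_factor [c Fc cE]] := hexagon_factor l_odd l_gt3 n_even n_gt2l j_odd H.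
exists F; split=> //; exists (hexagon j n_gt2l), c.
have y_lt : y <= u.2 + n.
  by move: y_hex; rewrite !inE; clear -n_gt3l l_gt3; lia.
split=> //.
  apply/mapP; exists y => //; rewrite [LHS]surjective_pairing (ord1 u.1).
  by congr (_, _); apply: val_inj; rewrite /= /j subnKC // modnDr modn_small.
rewrite cE; apply/mapP => -[z z_hex Ev].
by have := good z z_hex; rewrite Ev /= eqxx.
Qed.
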